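(* Let $m\ge 1$ be an integer. Then: (i) for every even integer $r$ with $2m\le r\le 2m+18\lfloor m/3\rfloor$ there exists a strongly regular graph with parameters $P_0(m)$ and 2-rank $r$; (ii) for every even integer $r$ with $2m+2\le r\le 2m+2+18\lfloor m/3\rfloor$ there exists a strongly regular graph with parameters $P_+(m)$ and 2-rank $r$; (iii) for every even integer $r$ with $2m+2\le r\le 2m+2+18\lfloor m/3\rfloor$ there exists a strongly regular graph with parameters $P_-(m)$ and 2-rank $r$.
   Context: A strongly regular graph with parameters $(n,k,\lambda,\mu)$ is a $k$-regular graph on $n$ vertices in which any two adjacent vertices have exactly $\lambda$ common neighbours and any two distinct non-adjacent vertices have exactly $\mu$ common neighbours. $P_0(m)=(2^{2m}-1,\,2^{2m-1},\,2^{2m-2},\,2^{2m-2})$ and $P_\pm(m)=(2^{2m},\,2^{2m-1}\pm2^{m-1},\,2^{2m-2}\pm2^{m-1},\,2^{2m-2}\pm2^{m-1})$. The 2-rank of a graph is the rank over $\mathbb{F}_2$ of its adjacency matrix. *)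

(* Defs.v *)
From mathcomp Require Import all_boot all_order all_algebra.
Set Implicit Arguments. Unset Strict Implicit. Unset Printing Implicit Defensive.
Import GRing.Theory.

Definition simple_graph (n : nat) (e : rel 'I_n) : Prop :=
  symmetric e /\ irreflexive e.

Definition srg (n k lam mu : nat) (e : rel 'I_n) : Prop :=
  simple_graph e /\
  (forall x : 'I_n, #|[set y | e x y]| = k) /\
  (forall x y : 'I_n, x != y -> e x y ->
      #|[set z | e x z && e y z]| = lam) /\
  (forall x y : 'I_n, x != y -> ~~ e x y ->
      #|[set z | e x z && e y z]| = mu).

Definition adj_F2 (n : nat) (e : rel 'I_n) : 'M['F_2]_n :=
  \matrix_(i < n, j < n) (e i j)%:R%R.

Definition two_rank (n : nat) (e : rel 'I_n) : nat := \rank (adj_F2 e).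

Definition P0 (m : nat) : nat * nat * nat * nat :=
  (2 ^ (2 * m) - 1, 2 ^ (2 * m - 1), 2 ^ (2 * m - 2), 2 ^ (2 * m - 2)).
Definition Pplus (m : nat) : nat * nat * nat * nat :=
  (2 ^ (2 * m), 2 ^ (2 * m - 1) + 2 ^ (m - 1),
   2 ^ (2 * m - 2) + 2 ^ (m - 1), 2 ^ (2 * m - 2) + 2 ^ (m - 1)).
Definition Pminus (m : nat) : nat * nat * nat * nat :=
  (2 ^ (2 * m), 2 ^ (2 * m - 1) - 2 ^ (m - 1),
   2 ^ (2 * m - 2) - 2 ^ (m - 1), 2 ^ (2 * m - 2) - 2 ^ (m - 1)).

Definition exists_srg_rank (p : nat * nat * nat * nat) (r : nat) : Prop :=
  let: (n, k, lam, mu) := p in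
  exists e : rel 'I_n, srg k lam mu e /\ two_rank e = r.

(* Main.v *)
From Stdlib Require Import BinNat.
Require Import Defs.
From mathcomp Require Import all_boot all_order all_algebra.
From mathcomp Require Import zify ring.

(** A graph with parameters [P_0(m)] is the core of a normalized symmetric
    Hadamard matrix [(-1)^A] of order [4^m] with constant diagonal, and its
    2-rank is the rank of the binary matrix [A].  The Kronecker product of two
    such matrices corresponds to [A (x) J + J (x) B], and since [A] and [B] have
    a zero row the ranks add up.  If [v] is a binary vector such that [(-1)^v]
    is an eigenvector of [(-1)^A], then [A + 1 v^T + v 1^T] is a graph with
    parameters [P_+(m)] or [P_-(m)], according to the sign of the eigenvalue;
    its 2-rank is that of [A] plus 2 when [v] is not in the column space of [A].
    Such eigenvectors also multiply under Kronecker products.  So it suffices to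
    find suitable matrices for [m = 1] with rank 2 and for [m = 3] with the ranks
    6, 8, ..., 24; these are explicit.  A binary symmetric matrix of rank [2k]
    with zero diagonal is a sum of [k] terms [p q^T + q p^T] with all the [p, q]
    independent, so the examples are given by lists of pairs [(p, q)]. *)

Set Implicit Arguments. Unset Strict Implicit. Unset Printing Implicit Defensive.
Import Order.TTheory GRing.Theory Num.Theory.
Local Open Scope ring_scope.

(** * Signs of binary values and sums of signs *)

Definition sgn (a : 'F_2) : int := if a == 0 then 1 else -1.

Lemma F2P (a : 'F_2) : a = 0 \/ a = 1.
Proof. by case: a => [[|[|//]] ?]; [left | right]; exact: val_inj. Qed.

Lemma F2_addxx (a : 'F_2) : a + a = 0.
Proof. by case: (F2P a) => ->; exact: val_inj. Qed.

Lemma F2_nat (a : 'F_2) : (a != 0)%:R = a.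
Proof. by case: (F2P a) => ->. Qed.

Lemma sgnD (a b : 'F_2) : sgn (a + b) = sgn a * sgn b.
Proof. by case: (F2P a) => ->; case: (F2P b) => ->. Qed.

Lemma sgn_sq (a : 'F_2) : sgn a * sgn a = 1.
Proof. by case: (F2P a) => ->. Qed.

Lemma card_sum (T : finType) (P : pred T) :
  #|[set x | P x]|%:Z = \sum_x (P x)%:R.
Proof.
rewrite -natz -sum1_card big_mkcond /= natr_sum.
by apply: eq_bigr => x _; rewrite inE; case: (P x).
Qed.

Lemma sum_sgn (T : finType) (f : T -> 'F_2) :
  \sum_x sgn (f x) = #|T|%:Z - 2 * #|[set x | f x != 0]|%:Z.
Proof.
rewrite !card_sum -[#|T|%:Z]natz -sum1_card natr_sum mulr_sumr -sumrB.
by apply: eq_bigr => x _; case: (F2P (f x)) => ->.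
Qed.

Lemma sum_sgnD (T : finType) (f g : T -> 'F_2) :
  \sum_x sgn (f x + g x) = #|T|%:Z - 2 * #|[set x | f x != 0]|%:Z
    - 2 * #|[set x | g x != 0]|%:Z
    + 4 * #|[set x | (f x != 0) && (g x != 0)]|%:Z.
Proof.
rewrite !card_sum -[#|T|%:Z]natz -sum1_card natr_sum !mulr_sumr -!sumrB -big_split /=.
by apply: eq_bigr => x _; case: (F2P (f x)) => ->; case: (F2P (g x)) => ->.
Qed.

(** * Graphs defined by alternating forms over the binary field *)

Definition pairing r (K : 'M['F_2]_r) (u w : 'rV_r) : 'F_2 :=
  (u *m K *m w^T) 0 0.

(** [model_span] says that the vectors [W x] span the whole space; with [K] invertible, this gives
    their Gram matrix rank exactly [r]. *)
Record symplectic_model (T : finType) r (W : T -> 'rV['F_2]_r) (K : 'M_r) : Prop := {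
  model_unit : K \in unitmx;
  model_sym : forall x y, pairing K (W x) (W y) = pairing K (W y) (W x);
  model_alt : forall x, pairing K (W x) (W x) = 0;
  model_span : forall c : 'cV_r, (forall x, W x *m c = 0) -> c = 0 }.

Definition model_rel (T : finType) r (W : T -> 'rV['F_2]_r) K : rel T :=
  fun x y => pairing K (W x) (W y) != 0.

Lemma card_enum_val (T : finType) (P : pred T) :
  #|[set i : 'I_#|T| | P (enum_val i)]| = #|[set x | P x]|.
Proof.
rewrite -!sum1_card [RHS](reindex _ (onW_bij _ (enum_val_bij T))) /=.
by apply: eq_bigl => i; rewrite !inE.
Qed.

(** The adjacency matrix factors as [M^T *m K *m M], where the columns of [M] are the vectors [W x].
    As [M] has full row rank and [K] is invertible, the rank is [r]. *)
Lemma model_srg (T : finType) r (W : T -> 'rV['F_2]_r) K k l :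
  symplectic_model W K ->
  (forall x, #|[set y | model_rel W K x y]| = k) ->
  (forall x y, x != y -> #|[set z | model_rel W K x z && model_rel W K y z]| = l) ->
  exists_srg_rank (#|T|, k, l, l) r.
Proof.
move=> [Ku Ks Ka Kspan] deg com.
exists (fun i j => model_rel W K (enum_val i) (enum_val j)); split.
  split; first by split=> [i j|i]; rewrite /model_rel (Ks, Ka) // Ka eqxx.
  split; first by move=> i; rewrite card_enum_val.
  have E i j : i != j -> enum_val i != enum_val j :> T.
    by apply: contra_neq; apply: enum_val_inj.
  by split=> i j /E ij _;
    rewrite (card_enum_val (fun z => model_rel W K _ z && model_rel W K _ z)) com.
rewrite /two_rank.
pose M : 'M['F_2]_(r, #|T|) := \matrix_(a, i) W (enum_val i) 0 a.
have rowM i : (col i M)^T = W (enum_val i).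
  by apply/rowP => a; rewrite !mxE.
have -> : adj_F2 (fun i j => model_rel W K (enum_val i) (enum_val j)) = M^T *m (K *m M).
  apply/matrixP => i j; rewrite !mxE F2_nat /pairing -!rowM !mxE.
  under eq_bigr => a _ do rewrite !mxE mulr_suml.
  under [RHS]eq_bigr => a _ do rewrite !mxE mulr_sumr.
  rewrite exchange_big /=; apply: eq_bigr => a _; apply: eq_bigr => b _.
  by rewrite !mxE mulrA.
(* A row vector killing [M] is orthogonal to every [W x], hence zero by the spanning condition. *)
have freeM : row_free M.
  apply: inj_row_free => v vM; apply: trmx_inj; rewrite trmx0; apply: Kspan => x.
  rewrite -[x]enum_rankK -rowM; apply: trmx_inj; rewrite trmx_mul !trmxK trmx0.
  by rewrite colE mulmxA vM mul0mx.
have fullM : row_full M^T by rewrite /row_full mxrank_tr.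
rewrite (eqmxMfull _ fullM) mxrankMfree // mxrank_unit //.
Qed.

Lemma sum_sgn_row (T : finType) r (W : T -> 'rV['F_2]_r) K x :
  \sum_z sgn (pairing K (W x) (W z)) =
  #|T|%:Z - 2 * #|[set z | model_rel W K x z]|%:Z.
Proof. exact: sum_sgn. Qed.

(** The left side is the inner product of two rows of the sign matrix; once degrees are known, it
    determines the number of common neighbours. *)
Lemma sum_sgn_rows (T : finType) r (W : T -> 'rV['F_2]_r) K x y :
  \sum_z sgn (pairing K (W x) (W z) + pairing K (W y) (W z)) =
  #|T|%:Z - 2 * #|[set z | model_rel W K x z]|%:Z
    - 2 * #|[set z | model_rel W K y z]|%:Z
    + 4 * #|[set z | model_rel W K x z && model_rel W K y z]|%:Z.
Proof. exact: sum_sgnD. Qed.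

Lemma pairing_block r1 r2 (K1 : 'M['F_2]_r1) (K2 : 'M_r2) u1 u2 w1 w2 :
  pairing (block_mx K1 0 0 K2) (row_mx u1 u2) (row_mx w1 w2) =
  pairing K1 u1 w1 + pairing K2 u2 w2.
Proof.
by rewrite /pairing mul_row_block !mulmx0 addr0 add0r tr_row_mx mul_row_col mxE.
Qed.

Lemma unitmx_block_diag r1 r2 (K1 : 'M['F_2]_r1) (K2 : 'M_r2) :
  K1 \in unitmx -> K2 \in unitmx -> block_mx K1 0 0 K2 \in unitmx.
Proof. by rewrite !unitmxE det_ublock unitrM => -> ->. Qed.

Definition hyperbolic k : 'M['F_2]_(k + k) := block_mx 0 1%:M 1%:M 0.

Lemma hyperbolic_unit k : hyperbolic k \in unitmx.
Proof.
suff /mulmx1_unit[] : hyperbolic k *m hyperbolic k = 1%:M by [].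
by rewrite mulmx_block !mulmx0 !mul0mx !mulmx1 !add0r addr0 -scalar_mx_block.
Qed.

Lemma pairing_hyperbolic k (a b c d : 'rV['F_2]_k) :
  pairing (hyperbolic k) (row_mx a b) (row_mx c d) =
  \sum_i (a 0 i * d 0 i + b 0 i * c 0 i).
Proof.
rewrite /pairing mul_row_block !mulmx0 !mulmx1 add0r addr0 tr_row_mx mul_row_col.
rewrite !mxE addrC big_split /=.
by congr (_ + _); apply: eq_bigr => i _; rewrite mxE.
Qed.

(** * Normalized Hadamard matrices and their eigenvectors *)

Record normalized_hadamard (m r : nat) (T : finType) (o : T)
    (W : T -> 'rV['F_2]_r) (K : 'M_r) : Prop := {
  had_model : symplectic_model W K;
  had_card : #|T| = (4 ^ m)%N;
  had_base : W o = 0;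
  had_orth : forall x y, x != y ->
    \sum_z sgn (pairing K (W x) (W z) + pairing K (W y) (W z)) = 0 }.

(* The vector with entries [sgn (v x)] is an eigenvector of the Hadamard matrix
   for [eps 2^m], so that conjugating by it makes all row sums equal. *)
Record switching_vector (m r : nat) (T : finType) (o : T)
    (W : T -> 'rV['F_2]_r) (K : 'M_r) (eps : int) (v : T -> 'F_2) : Prop := {
  sw_base : v o = 0;
  sw_eigen : forall x, \sum_y sgn (pairing K (W x) (W y) + v y) =
    eps * (2 ^ m)%N%:Z * sgn (v x);
  sw_free : forall c : 'cV_r, ~ forall x, v x = (W x *m c) 0 0 }.

(** Both eigenvalue signs are kept on the same matrix, so that one construction serves all three
    parameter families. *)
Definition switchable (m r : nat) : Prop :=
  exists (T : finType) (o : T) (W : T -> 'rV['F_2]_r) (K : 'M_r) (vp vm : T -> 'F_2),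
    [/\ normalized_hadamard m o W K,
        switching_vector m o W K 1 vp & switching_vector m o W K (-1) vm].

(** * Kronecker products *)

Section Product.
Variables (m1 m2 r1 r2 : nat) (T1 T2 : finType) (o1 : T1) (o2 : T2).
Variables (W1 : T1 -> 'rV['F_2]_r1) (K1 : 'M['F_2]_r1).
Variables (W2 : T2 -> 'rV['F_2]_r2) (K2 : 'M['F_2]_r2).
Hypotheses (H1 : normalized_hadamard m1 o1 W1 K1) (H2 : normalized_hadamard m2 o2 W2 K2).

Definition tensorW (x : T1 * T2) := row_mx (W1 x.1) (W2 x.2).
Definition tensorK := block_mx K1 0 0 K2.

Lemma sum_sgn_prod (f : T1 -> 'F_2) (g : T2 -> 'F_2) :
  \sum_(z : T1 * T2) sgn (f z.1 + g z.2) = (\sum_x sgn (f x)) * (\sum_y sgn (g y)).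
Proof.
rewrite big_distrlr /= pair_big /=.
by apply: eq_bigr => -[x y] _; rewrite sgnD.
Qed.

Lemma tensor_hadamard : normalized_hadamard (m1 + m2) (o1, o2) tensorW tensorK.
Proof.
case: H1 H2 => -[u1 s1 a1 p1] c1 b1 h1 [[u2 s2 a2 p2] c2 b2 h2].
split.
- split.
  + exact: unitmx_block_diag.
  + by move=> x y; rewrite !pairing_block s1 s2.
  + by move=> x; rewrite pairing_block a1 a2 addr0.
  + move=> c; rewrite -[c]vsubmxK => Wc.
    (* Setting either coordinate to its base point, where the vector vanishes, separates the two
       halves of [c]. *)
    have E x y : W1 x *m usubmx c + W2 y *m dsubmx c = 0.
      by rewrite -(Wc (x, y)) mul_row_col.
    have -> : usubmx c = 0.
      by apply: p1 => x; rewrite -(E x o2) b2 mul0mx addr0.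
    have -> : dsubmx c = 0.
      by apply: p2 => y; rewrite -(E o1 y) b1 mul0mx add0r.
    exact: col_mx0.
- by rewrite card_prod c1 c2 expnD.
- by rewrite /tensorW b1 b2 row_mx0.
- move=> [x1 x2] [y1 y2] neq.
  pose A1 x z := pairing K1 (W1 x) (W1 z); pose A2 x z := pairing K2 (W2 x) (W2 z).
  rewrite (eq_bigr (fun z => sgn ((A1 x1 z.1 + A1 y1 z.1) + (A2 x2 z.2 + A2 y2 z.2)))).
    rewrite (sum_sgn_prod (fun z => A1 x1 z + A1 y1 z) (fun z => A2 x2 z + A2 y2 z)).
    (* The inner product is a product of two, and distinct pairs differ in some coordinate, where
       the factor vanishes. *)
    have [e1|n1] := eqVneq x1 y1; last by rewrite h1 // mul0r.
    by rewrite h2 ?mulr0 //; move: neq; rewrite e1 xpair_eqE eqxx.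
  by move=> z _; rewrite !pairing_block addrACA.
Qed.

Lemma tensor_switching e1 e2 v1 v2 :
  switching_vector m1 o1 W1 K1 e1 v1 -> switching_vector m2 o2 W2 K2 e2 v2 ->
  switching_vector (m1 + m2) (o1, o2) tensorW tensorK (e1 * e2)
    (fun x => v1 x.1 + v2 x.2).
Proof.
case=> b1 E1 f1 [b2 E2 f2]; split.
- by rewrite b1 b2 addr0.
- move=> [x1 x2] /=.
  pose A1 z := pairing K1 (W1 x1) (W1 z); pose A2 z := pairing K2 (W2 x2) (W2 z).
  rewrite (eq_bigr (fun z => sgn ((A1 z.1 + v1 z.1) + (A2 z.2 + v2 z.2)))).
    rewrite (sum_sgn_prod (fun z => A1 z + v1 z) (fun z => A2 z + v2 z)) E1 E2.
    by rewrite sgnD expnD PoszM; ring.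
  by move=> z _; rewrite pairing_block addrACA.
(* On the slice with second coordinate [o2], a linear expression for the product vector restricts to
   one for [v1]. *)
- move=> c Ec; apply: (f1 (usubmx c)) => x.
  have := Ec (x, o2); rewrite /= b2 addr0 -{1}[c]vsubmxK mul_row_col mxE => ->.
  by rewrite -[RHS]addr0 (had_base H2) mul0mx; congr (_ + _); rewrite mxE.
Qed.

End Product.

Lemma switchable_mul m1 m2 r1 r2 :
  switchable m1 r1 -> switchable m2 r2 -> switchable (m1 + m2) (r1 + r2).
Proof.
move=> [T1 [o1 [W1 [K1 [p1 [n1 [H1 P1 N1]]]]]]] [T2 [o2 [W2 [K2 [p2 [n2 [H2 P2 N2]]]]]]].
exists (T1 * T2)%type, (o1, o2), (tensorW W1 W2), (tensorK K1 K2).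
exists (fun x => p1 x.1 + p2 x.2), (fun x => p1 x.1 + n2 x.2); split.
- exact: tensor_hadamard.
- by rewrite -[1]mulr1; apply: tensor_switching.
- by rewrite -[-1]mul1r; apply: tensor_switching.
Qed.

(** * From Hadamard matrices to strongly regular graphs *)

(** The row of [o] consists of ones, so orthogonality to it makes every other row balanced. *)
Lemma hadamard_deg m r (T : finType) (o : T) (W : T -> 'rV['F_2]_r) K x :
  normalized_hadamard m o W K -> x != o ->
  2 * #|[set y | model_rel W K x y]|%:Z = (4 ^ m)%N%:Z.
Proof.
move=> [_ c b h] /h; rewrite (eq_bigr (fun z => sgn (pairing K (W x) (W z)))).
  by rewrite sum_sgn_row c; lia.
by move=> z _; rewrite b {2}/pairing !mul0mx mxE addr0.
Qed.

(** The base point is an isolated vertex with zero vector: deleting it changes neither neighbour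
    counts nor the span. *)
Lemma switchable_P0 m r : (0 < m)%N -> switchable m r -> exists_srg_rank (P0 m) r.
Proof.
move=> m0 [T [o [W [K [_ [_ [H _ _]]]]]]].
have [[Ku Ks Ka Kp] c b h] := H.
pose V := {x : T | x != o}.
have oE z : pairing K (W z) (W o) = 0 by rewrite b /pairing trmx0 mulmx0 mxE.
have cardV (P : pred T) : ~~ P o -> #|[set y : V | P (val y)]| = #|[set x | P x]|.
  move=> Po; rewrite -(card_imset _ val_inj); apply: eq_card => x.
  apply/imsetP/idP => [[y]|]; first by rewrite !inE => Py ->.
  rewrite inE => Px; have xo : x != o by apply: contraNneq Po => <-.
  by exists (Sub x xo); rewrite ?inE SubK.
have e4 : (4 ^ m = 4 * 2 ^ (2 * m - 2))%N.
  by rewrite -[4%N]/(2 ^ 2)%N -expnM -expnD; congr (_ ^ _)%N; lia.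
have e2 : (2 ^ (2 * m - 1) = 2 * 2 ^ (2 * m - 2))%N.
  by rewrite -expnS; congr (_ ^ _)%N; lia.
have cV : #|{: V}| = (2 ^ (2 * m) - 1)%N.
  by rewrite card_sub cardC1 c expnM subn1.
rewrite /P0 -cV; apply: (@model_srg V r (fun x => W (val x)) K).
- split=> [|x y|x|d Wd]; [exact: Ku|exact: Ks|exact: Ka|].
  apply: Kp => x; have [->|xo] := eqVneq x o; first by rewrite b mul0mx.
  exact: (Wd (Sub x xo)).
- move=> x; rewrite (cardV (fun y => model_rel W K (val x) y)).
    by have := hadamard_deg H (valP x); lia.
  by rewrite /model_rel oE eqxx.
- move=> x y xy.
  rewrite (cardV (fun z => model_rel W K (val x) z && model_rel W K (val y) z)).
    have := hadamard_deg H (valP x); have := hadamard_deg H (valP y).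
    have := h (val x) (val y) xy; rewrite sum_sgn_rows c; lia.
  by rewrite /model_rel oE eqxx.
Qed.

(** Adjoining a hyperbolic plane with coordinates [(1, v x)] adds [v x + v y] to the pairing, and so
    realizes the switching with two more dimensions. The eigenvector equation gives the degree, row
    orthogonality the common neighbours. *)
Lemma switching_srg m r (T : finType) (o : T) (W : T -> 'rV['F_2]_r) K eps v k l :
  normalized_hadamard m o W K -> switching_vector m o W K eps v ->
  2 * k%:Z = (4 ^ m)%N%:Z - eps * (2 ^ m)%N%:Z ->
  4 * l%:Z = (4 ^ m)%N%:Z - 2 * eps * (2 ^ m)%N%:Z ->
  exists_srg_rank ((4 ^ m)%N, k, l, l) (r + 2).
Proof.
move=> [[Ku Ks Ka Kp] c b h] [vo ve vf] kE lE; rewrite -c.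
pose W' x : 'rV_(r + (1 + 1)) := row_mx (W x) (row_mx 1%:M (v x)%:M).
pose K' := block_mx K 0 0 (hyperbolic 1).
have A x y : pairing K' (W' x) (W' y) = pairing K (W x) (W y) + v x + v y.
  rewrite pairing_block pairing_hyperbolic big_ord1 !mxE !eqxx !mulr1n mul1r mulr1.
  by rewrite -addrA [v y + _]addrC.
have deg x : #|[set y | model_rel W' K' x y]| = k.
  have := sum_sgn_row W' K' x.
  rewrite (eq_bigr (fun y => sgn (v x) * sgn (pairing K (W x) (W y) + v y))); last first.
    by move=> y _; rewrite A addrAC [LHS]sgnD mulrC.
  rewrite -mulr_sumr ve mulrCA sgn_sq mulr1 c; lia.
apply: (model_srg (W := W') (K := K')) => // [|x y /h h0].
- split.
  + exact: unitmx_block_diag Ku (hyperbolic_unit 1).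
  + by move=> x y; rewrite !A Ks addrAC.
  + by move=> x; rewrite A Ka add0r F2_addxx.
  + move=> d; rewrite -[d]vsubmxK -[dsubmx d]vsubmxK.
    set d1 := usubmx d; set s := usubmx _; set t := dsubmx _ => Wd.
    have E x : (W x *m d1) 0 0 + (s 0 0 + v x * t 0 0) = 0.
      have /matrixP/(_ 0 0) := Wd x.
      by rewrite !mul_row_col mul1mx mul_scalar_mx !mxE.
    have s0 : s 0 0 = 0.
      by have := E o; rewrite b vo mul0mx mxE mul0r add0r addr0.
    (* If [t] were 1, [v] would be a linear function of [W], against [sw_free]. *)
    have t0 : t 0 0 = 0.
      have [//|t1] := F2P (t 0 0); case: (vf d1) => x.
      have := E x; rewrite s0 t1 mulr1 add0r => E0.
      by rewrite -[LHS]add0r -E0 -addrA F2_addxx addr0.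
    have -> : d1 = 0.
      apply: Kp => x; apply/matrixP => i j; rewrite !ord1 [RHS]mxE -(E x) s0 t0.
      by rewrite mulr0 !addr0.
    have -> : s = 0 by apply/matrixP => i j; rewrite !ord1 s0 mxE.
    have -> : t = 0 by apply/matrixP => i j; rewrite !ord1 t0 mxE.
    by rewrite !col_mx0.
- have := sum_sgn_rows W' K' x y.
  (* The terms [v z] cancel, so switching only multiplies the inner product by a constant sign. *)
  rewrite (eq_bigr (fun z => sgn (v x + v y) *
      sgn (pairing K (W x) (W z) + pairing K (W y) (W z)))); last first.
    move=> z _; rewrite -sgnD !A; congr sgn.
    rewrite [in LHS]addrACA F2_addxx addr0 addrACA addrC //.
  rewrite -mulr_sumr h0 mulr0 c.
  have := deg x; have := deg y; lia.
Qed.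

Lemma pow2_expansion m :
  [/\ (2 ^ (2 * m.+1) = 4 ^ m.+1)%N, (4 ^ m.+1 = 4 * (2 ^ m * 2 ^ m))%N,
      (2 ^ (2 * m.+1 - 1) = 2 * (2 ^ m * 2 ^ m))%N,
      (2 ^ (2 * m.+1 - 2) = 2 ^ m * 2 ^ m)%N & (2 ^ m.+1 = 2 * 2 ^ m)%N].
Proof.
split.
- by rewrite expnM.
- by rewrite expnS -expnMn.
- by rewrite -expnD -expnS; congr (_ ^ _)%N; lia.
- by rewrite -expnD; congr (_ ^ _)%N; lia.
- by rewrite expnS.
Qed.

(** A row sum is the order minus twice the degree, so the larger degree comes from the eigenvalue
    with [eps = -1]. *)
Lemma switchable_Pplus m r :
  (0 < m)%N -> switchable m r -> exists_srg_rank (Pplus m) (r + 2).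
Proof.
case: m => // m _ [T [o [W [K [_ [v [H _ Hv]]]]]]].
have [e1 e2 e3 e4 e5] := pow2_expansion m.
by rewrite /Pplus e1; apply: (switching_srg H Hv); rewrite ?e2 ?e3 ?e4 ?e5 subn1 /=; nia.
Qed.

Lemma switchable_Pminus m r :
  (0 < m)%N -> switchable m r -> exists_srg_rank (Pminus m) (r + 2).
Proof.
case: m => // m _ [T [o [W [K [v [_ [H Hv _]]]]]]].
have [e1 e2 e3 e4 e5] := pow2_expansion m.
have a0 : (0 < 2 ^ m)%N by rewrite expn_gt0.
by rewrite /Pminus e1; apply: (switching_srg H Hv); rewrite ?e2 ?e3 ?e4 ?e5 subn1 /=; nia.
Qed.

(** * Computable certificates *)

Definition bit (w : N) (x : nat) : bool := N.testbit w (N.of_nat x).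

Lemma bit_lxor u w x : bit (N.lxor u w) x = bit u x (+) bit w x.
Proof. by rewrite /bit N.lxor_spec; do 2 case: N.testbit. Qed.

(** Gaussian elimination on bit words: the pivot [x] is the lowest set bit of the head ([find]
    returns [n] if there is none) and is cleared from the tail. The tail is rewritten before the
    recursive call, hence the fuel. *)
Fixpoint independent (n fuel : nat) (ws : seq N) : bool :=
  match fuel, ws with
  | _, [::] => true
  | k.+1, w :: ws' =>
      let x := find (bit w) (iota 0 n) in
      (x < n)%N && independent n k [seq if bit u x then N.lxor u w else u | u <- ws']
  | _, _ => false
  end.

Lemma F2_addb (a b : bool) : (a (+) b)%:R = a%:R + b%:R :> 'F_2.
Proof. by case: a; case: b; apply: val_inj. Qed.

Lemma F2_andb (a b : bool) : (a && b)%:R = a%:R * b%:R :> 'F_2.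
Proof. by case: a; case: b; apply: val_inj. Qed.

Lemma independentP n fuel ws (cs : seq 'F_2) :
  independent n fuel ws -> size cs = size ws ->
  (forall x, (x < n)%N -> \sum_(p <- zip cs ws) p.1 * (bit p.2 x)%:R = 0) ->
  cs = nseq (size ws) 0.
Proof.
elim: fuel ws cs => [|k IHk] [|w ws] [|c cs] //=.
set x := find _ _ => /andP[xn /IHk{}IHk] [sz] E.
have wx : bit w x.
  have hw : has (bit w) (iota 0 n) by rewrite has_find size_iota.
  by have := nth_find 0%N hw; rewrite -/x nth_iota.
have cx : c + \sum_(p <- zip cs ws) p.1 * (bit p.2 x)%:R = 0.
  by have := E x xn; rewrite big_cons /= wx mulr1.
have cs0 : cs = nseq (size ws) 0.
  rewrite -[X in nseq X](size_map (fun u => if bit u x then N.lxor u w else u)).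
  apply: IHk => [|y yn]; first by rewrite size_map.
  have -> : zip cs [seq if bit u x then N.lxor u w else u | u <- ws] =
      [seq (p.1, if bit p.2 x then N.lxor p.2 w else p.2) | p <- zip cs ws].
    by elim: (cs) (ws) => [|a l IH] [|b l'] //=; rewrite IH.
  rewrite big_map /=.
  rewrite (eq_bigr (fun p => p.1 * (bit p.2 y)%:R + p.1 * (bit p.2 x)%:R * (bit w y)%:R)).
    rewrite big_split /= -mulr_suml; have := E y yn; rewrite big_cons /=.
    set S := \sum_(_ <- _) _; move: cx; set S' := \sum_(_ <- _) _ => cx Ey.
    (* In characteristic 2 the equation at the pivot gives [S' = c], so the reduced words satisfy
       the original relation with the same coefficients [cs]. *)
    have -> : S' = c by rewrite -[LHS]add0r -[in LHS](F2_addxx c) -addrA cx addr0.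
    by rewrite addrC.
  move=> p _; rewrite -mulrA -mulrDr -F2_andb -F2_addb.
  by case: (bit p.2 x); rewrite ?addbF // bit_lxor.
have zsum l : \sum_(p <- zip (nseq (size l) (0 : 'F_2)) l) p.1 * (bit p.2 x)%:R = 0.
  by elim: l => [|a l IH] /=; rewrite ?big_nil // big_cons /= mul0r add0r.
by move: cx; rewrite cs0 zsum addr0 => ->.
Qed.

Definition form_adj (s : seq (N * N)) (x y : nat) : bool :=
  foldr (fun pq b => (bit pq.1 x && bit pq.2 y) (+) (bit pq.2 x && bit pq.1 y) (+) b)
    false s.

Definition form_table n s := mkseq (fun x => mkseq (form_adj s x) n) n.

Definition rows_orthogonal n (A : seq (seq bool)) : bool :=
  pairwise (fun a b => (count (fun p => p.1 (+) p.2) (zip a b)).*2 == n) A.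

Definition switched_degree n (A : seq (seq bool)) (v : seq bool) k : bool :=
  all (fun x => count (fun p => p.1 (+) p.2 (+) nth false v x)
                  (zip (nth [::] A x) v) == k) (iota 0 n).

(** Clear bits at position 0 make it the base point; the degrees [(n - 2 ^ m)./2] and
    [(n + 2 ^ m)./2] encode the eigenvalues [2 ^ m] and [- 2 ^ m]. *)
Definition switchable_cert m (s : seq (N * N)) (vp vm : N) : bool :=
  let n := (4 ^ m)%N in
  let A := form_table n s in
  let ws := unzip1 s ++ unzip2 s in
  [&& all (fun w => ~~ bit w 0) [:: vp, vm & ws],
      rows_orthogonal n A,
      switched_degree n A (mkseq (bit vp) n) (n - 2 ^ m)./2,
      switched_degree n A (mkseq (bit vm) n) (n + 2 ^ m)./2,
      independent n (size ws).+1 (rcons ws vp) &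
      independent n (size ws).+1 (rcons ws vm)].

(* Encodings of pairs of subsets of [{0..63}] by their characteristic bits.  The
   first three pairs of [chain1] are the standard symplectic form on [F_2^6].
   The other pairs of [chain1], and the last three of [chain2], are
   Godsil-McKay switchings with respect to 4-sets [p]; they were found by
   computer search so that every prefix of [chain1] with at least 3 pairs, and
   every prefix of [chain2] with at least 9 pairs, gives a Hadamard matrix, with the
   same two eigenvectors along each chain. *)
Definition chain1 : seq (N * N) := [::
  (0xaaaaaaaaaaaaaaaa, 0xcccccccccccccccc); (0xf0f0f0f0f0f0f0f0, 0xff00ff00ff00ff00);
  (0xffff0000ffff0000, 0xffffffff00000000); (0x200000210000010, 0xc03030c00c03030c);
  (0xa00000a000000000, 0x80a0a08b0a0a0b0); (0xc0000c00000, 0xcc0c00cc00c0cc0);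
  (0x30000003000000, 0xcc0c00c0cc0c00c); (0x40000440000400, 0x3f00f00c00f000);
  (0x2020000202000, 0xb0f004400f0b00)]%num.

Definition chain2 : seq (N * N) := [::
  (0x4e4f54ccfc4cf884, 0xa8abaa8bb8aaba8a); (0x55ecf2c52f5e330, 0x7fa07f215d00fb28);
  (0x4c1702fd2061400, 0xf9de526d29da1260); (0xf7ef2db4b42d0180, 0xfc826500cb80d340);
  (0x3e30860b2a83800, 0x659d07de60c1b300); (0xfc9b4fc627234000, 0x2630a6896a83200);
  (0x9edb70ac98482000, 0x6747c88745351000); (0x6126c757d8cc0000, 0x9a59751cb3190000);
  (0xff00ff00000, 0x660b00b20020000); (0x4000010000100004, 0xa50a005500a05a0);
  (0x8000202008, 0x8502020aa8000050); (0x5000000000500000, 0x404527003054850)]%num.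

(** Prefixes of 3 to 9 pairs give the ranks 6 to 18. *)
Lemma chain1_cert :
  all (fun k => switchable_cert 3 (take k chain1)
                  0x8878778788788878%num 0xd2ddd2ddd2dd2d22%num) (iota 3 7).
Proof. by vm_compute. Qed.

(** Prefixes of 10 to 12 pairs give the ranks 20 to 24. *)
Lemma chain2_cert :
  all (fun k => switchable_cert 3 (take k chain2)
                  0x4716e146b0306ed4%num 0x6e9f2e1371e5f836%num) (iota 10 3).
Proof. by vm_compute. Qed.

(** On the binary plane with its symplectic form, [0x8] is the hyperbolic quadratic form [xy] and
    [0xe] the elliptic form [x^2 + xy + y^2]. *)
Lemma K4_cert : switchable_cert 1 [:: (0xa, 0xc)]%num 0x8%num 0xe%num.
Proof. by vm_compute. Qed.

(** * Soundness of the certificates *)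

Lemma card_ord_count n (f : nat -> bool) : #|[set i : 'I_n | f i]| = count f (iota 0 n).
Proof.
rewrite -sum1_count -sum1_card big_mkcond [RHS]big_mkcond /=.
rewrite -[n in iota 0 n]subn0 -/(index_iota 0 n) big_mkord.
by apply: eq_bigr => i _; rewrite inE.
Qed.

Lemma sum_sgn_ord n (f : nat -> bool) :
  \sum_(i < n) sgn (f i)%:R = n%:Z - 2 * (count f (iota 0 n))%:Z.
Proof.
rewrite sum_sgn card_ord -card_ord_count; congr (_ - 2 * (Posz _)).
by apply: eq_card => i; rewrite !inE; case: (f i).
Qed.

Lemma nth_form_table n s x : (x < n)%N ->
  nth [::] (form_table n s) x = mkseq (form_adj s x) n.
Proof. by move=> xn; rewrite nth_mkseq. Qed.

Lemma zip_mkseq A B n (f : nat -> A) (g : nat -> B) :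
  zip (mkseq f n) (mkseq g n) = mkseq (fun i => (f i, g i)) n.
Proof. by rewrite /mkseq; elim: (iota 0 n) => //= i l ->. Qed.

Section Certificate.
Variables (s : seq (N * N)) (n : nat).
Local Notation k := (size s).

Definition formW (x : 'I_n) : 'rV['F_2]_(k + k) :=
  row_mx (\row_(i < k) (bit (tnth (in_tuple s) i).1 x)%:R)
         (\row_(i < k) (bit (tnth (in_tuple s) i).2 x)%:R).

Lemma formW_pairing (x y : 'I_n) :
  pairing (hyperbolic k) (formW x) (formW y) = (form_adj s x y)%:R.
Proof.
rewrite pairing_hyperbolic.
transitivity (\sum_(pq <- s)
  ((bit pq.1 x && bit pq.2 y) (+) (bit pq.2 x && bit pq.1 y))%:R : 'F_2).
  rewrite (big_tnth _ _ s) /=; apply: eq_bigr => i _.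
  by rewrite !mxE F2_addb !F2_andb.
rewrite /form_adj; elim: s => [|pq l IH]; first by rewrite big_nil.
by rewrite big_cons /= [RHS]F2_addb IH.
Qed.

(** The coefficient [t] serves two uses: [t = 0] yields the spanning condition, and [t = 1] shows
    that [v] is no linear function of [formW]. *)
Lemma formW_independent (v : N) (c : 'cV_(k + k)) (t : 'F_2) :
  independent n (size (unzip1 s ++ unzip2 s)).+1 (rcons (unzip1 s ++ unzip2 s) v) ->
  (forall x, (formW x *m c) 0 0 + t * (bit v x)%:R = 0) -> c = 0 /\ t = 0.
Proof.
rewrite -[c]vsubmxK; set a := usubmx c; set b := dsubmx c => /independentP ind E.
pose f i := tnth (in_tuple s) i.
have sE : s = [seq f i | i <- enum 'I_k] by rewrite map_tnth_enum.
have s1 : unzip1 s = [seq (f i).1 | i <- enum 'I_k] by rewrite {1}sE /unzip1 -map_comp.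
have s2 : unzip2 s = [seq (f i).2 | i <- enum 'I_k] by rewrite {1}sE /unzip2 -map_comp.
pose la := [seq a i 0 | i <- enum 'I_k]; pose lb := [seq b i 0 | i <- enum 'I_k].
have sz A (h : 'I_k -> A) : size [seq h i | i <- enum 'I_k] = k.
  by rewrite size_map size_enum_ord.
have szl : size (la ++ lb) = size (unzip1 s ++ unzip2 s).
  by rewrite !size_cat !sz !size_map.
have := ind (rcons (la ++ lb) t); rewrite !size_rcons szl => /(_ erefl) {}ind.
have /ind : forall x, (x < n)%N ->
    \sum_(p <- zip (rcons (la ++ lb) t) (rcons (unzip1 s ++ unzip2 s) v))
       p.1 * (bit p.2 x)%:R = 0.
  move=> x xn; rewrite -[RHS](E (Ordinal xn)) mul_row_col mxE.
  rewrite zip_rcons // s1 s2.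
  rewrite zip_cat ?sz // !zip_map -cats1 !big_cat !big_map big_seq1 /=.
  rewrite -!enumT !big_enum /= !mxE; congr (_ + _ + _).
  - by apply: eq_bigr => i _; rewrite !mxE mulrC.
  - by apply: eq_bigr => i _; rewrite !mxE mulrC.
move=> z.
have zin u : u \in rcons (la ++ lb) t -> u = 0 by rewrite z => /nseqP[].
have t0 : t = 0 by apply: zin; rewrite mem_rcons inE eqxx.
split=> //.
have -> : a = 0.
  apply/matrixP => i j; rewrite ord1 [RHS]mxE; apply: zin.
  by rewrite mem_rcons inE mem_cat (map_f (fun i => a i 0)) ?mem_enum ?orbT.
have -> : b = 0.
  apply/matrixP => i j; rewrite ord1 [RHS]mxE; apply: zin.
  by rewrite mem_rcons inE mem_cat (map_f (fun i => b i 0)) ?mem_enum ?orbT.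
exact: col_mx0.
Qed.

End Certificate.

Lemma switchable_certP m s vp vm :
  switchable_cert m s vp vm -> switchable m (size s + size s).
Proof.
case/and5P; set n := (4 ^ m)%N; set ws := unzip1 s ++ unzip2 s.
move=> /allP base orth degp degm /andP[indp indm].
have n0 : (0 < n)%N by rewrite expn_gt0.
have A := formW_pairing.
pose o : 'I_n := Ordinal n0.
have base0 w : w \in [:: vp, vm & ws] -> bit w 0 = false by move=> /base /negbTE.
have W0 : formW s o = 0.
  apply/rowP => j; rewrite !mxE; case: splitP => i _; rewrite !mxE base0 //.
  - by rewrite !inE mem_cat map_f ?orbT // mem_tnth.
  - by rewrite !inE mem_cat (map_f (fun x => x.2)) ?orbT // mem_tnth.
have H : normalized_hadamard m o (@formW s n) (hyperbolic (size s)).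
  split=> //; last 1 first.
  - move=> x y xy.
    rewrite (eq_bigr (fun z : 'I_n =>
        sgn (form_adj s x z (+) form_adj s y z)%:R)); last first.
      by move=> z _; rewrite !A F2_addb.
    rewrite (sum_sgn_ord n (fun z => form_adj s x z (+) form_adj s y z)).
    (* The pairwise test covers only rows in increasing order; the sum is symmetric in [x] and
       [y]. *)
    wlog lt : x y xy / (x < y)%N.
      move=> th; have [lt|gt|/val_inj e] := ltngtP x y; [exact: th| |by rewrite e eqxx in xy].
      rewrite -(th y x) 1?eq_sym //; congr (_ - 2 * (Posz _)).
      by apply: eq_count => z; rewrite addbC.
    have := pairwiseP [::] orth x y.
    rewrite /= !inE size_mkseq !ltn_ord => /(_ isT isT lt).
    rewrite !nth_form_table // zip_mkseq count_map => /eqP.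
    rewrite (@eq_count _ _ (fun z => form_adj s x z (+) form_adj s y z)) //.
    by move=> e; lia.
  - split.
    + exact: hyperbolic_unit.
    + move=> x y; rewrite !A; congr (_%:R); congr nat_of_bool.
      rewrite /form_adj; elim: (s) => //= pq l ->; congr (_ (+) _).
      by rewrite addbC andbC [X in X (+) _]andbC addbC andbC; do 4 case: bit.
    + move=> x; rewrite A /form_adj; elim: (s) => //= pq l IH.
      by rewrite andbC addbb.
    + move=> c Wc; suff [] : c = 0 /\ 0 = 0 :> 'F_2 by [].
      apply: (formW_independent indp) => x; rewrite Wc mxE mul0r addr0 //.
  - by rewrite card_ord.
have sw v eps k : v \in [:: vp; vm] ->
    switched_degree n (form_table n s) (mkseq (bit v) n) k ->
    independent n (size ws).+1 (rcons ws v) ->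
    n%:Z - 2 * k%:Z = eps * (2 ^ m)%N%:Z ->
    switching_vector m o (@formW s n) (hyperbolic (size s)) eps (fun x => (bit v x)%:R).
  move=> vin /allP deg ind kE; split.
  - by rewrite base0 //; move: vin; rewrite !inE => /orP[] ->; rewrite ?orbT.
  - move=> x; have xn : (x : nat) \in iota 0 n by rewrite mem_iota /=.
    have := deg _ xn; rewrite nth_form_table // zip_mkseq count_map nth_mkseq //.
    rewrite (@eq_count _ _ (fun z => form_adj s x z (+) bit v z (+) bit v x)) // => /eqP dE.
    (* The certificate counts ones in the switched row, which carries an extra [bit v x]; factoring
       out its sign recovers the eigenvector equation. *)
    rewrite (eq_bigr (fun y : 'I_n => sgn (bit v x)%:R *
        sgn (form_adj s x y (+) bit v y (+) bit v x)%:R)).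
      rewrite -mulr_sumr (sum_sgn_ord n (fun y => form_adj s x y (+) bit v y (+) bit v x)).
      by rewrite dE kE mulrC.
    by move=> y _; rewrite A -F2_addb -sgnD -F2_addb [in RHS]addbC addbK.
  - move=> c Ec; suff [_ /eqP] : c = 0 /\ 1 = 0 :> 'F_2 by rewrite oner_eq0.
    by apply: (formW_independent ind) => x; rewrite mul1r Ec F2_addxx.
exists 'I_n, o, (@formW s n), (hyperbolic (size s)).
have e4 : (4 ^ m = 2 ^ m * 2 ^ m)%N by rewrite -expnMn.
(* Parity makes the halvings in the certificate exact, and the next inequality keeps its subtraction
   from truncating. *)
have ev : ~~ odd (2 ^ m * 2 ^ m + 2 ^ m) by rewrite oddD oddM; case: odd.
have ge : (2 ^ m <= 2 ^ m * 2 ^ m)%N by rewrite leq_pmull // expn_gt0.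
exists (fun x : 'I_n => (bit vp x)%:R), (fun x : 'I_n => (bit vm x)%:R); split=> //.
- apply: sw degp indp _; first by rewrite !inE eqxx.
  move: ev ge; rewrite /n e4; set q := (_ * _)%N; lia.
- apply: sw degm indm _; first by rewrite !inE eqxx orbT.
  move: ev ge; rewrite /n e4; set q := (_ * _)%N; lia.
Qed.

(** * Assembling the range of ranks *)

Lemma switchable_K4 : switchable 1 2.
Proof. exact: (switchable_certP K4_cert). Qed.

Lemma switchable_order64 r : ~~ odd r -> (6 <= r <= 24)%N -> switchable 3 r.
Proof.
move=> evr /andP[r6 r24].
have rE : r = (r./2 + r./2)%N by rewrite addnn even_halfK.
have [small|big] := leqP r 18.
- have /(allP chain1_cert)/switchable_certP : r./2 \in iota 3 7 by rewrite mem_iota; lia.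
  by rewrite size_takel -?rE //=; lia.
- have /(allP chain2_cert)/switchable_certP : r./2 \in iota 10 3 by rewrite mem_iota; lia.
  by rewrite size_takel -?rE //=; lia.
Qed.

Lemma switchable_range m r : (0 < m)%N -> ~~ odd r ->
  (2 * m <= r <= 2 * m + 18 * (m %/ 3))%N -> switchable m r.
Proof.
elim/ltn_ind: m r => m IH r m0 evr rng.
have [m3|] := ltnP 3 m.
  (* The factor of order 64 takes as much rank as it can, up to 24, while leaving at least the
     minimum [2 * (m - 3)] to the rest. *)
  pose r1 := minn 24 (r - 2 * (m - 3)).
  have -> : m = (3 + (m - 3))%N by lia.
  have -> : r = (r1 + (r - r1))%N by rewrite /r1; lia.
  apply: switchable_mul; first by apply: switchable_order64; rewrite /r1; lia.
  by apply: IH; rewrite /r1; lia.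
case: m => [|[|[|[|//]]]] // in IH m0 rng * => _.
- have -> : r = 2%N by lia.
  exact: switchable_K4.
- have -> : r = (2 + 2)%N by lia.
  exact: (switchable_mul switchable_K4 switchable_K4).
- by apply: switchable_order64 => //; lia.
Qed.

Local Close Scope ring_scope.

Theorem theorem7p1 (m : nat) (hm : 1 <= m) :
  (forall r : nat, ~~ odd r -> 2 * m <= r <= 2 * m + 18 * (m %/ 3) ->
     exists_srg_rank (P0 m) r) /\
  (forall r : nat, ~~ odd r -> 2 * m + 2 <= r <= 2 * m + 2 + 18 * (m %/ 3) ->
     exists_srg_rank (Pplus m) r) /\
  (forall r : nat, ~~ odd r -> 2 * m + 2 <= r <= 2 * m + 2 + 18 * (m %/ 3) ->
     exists_srg_rank (Pminus m) r).
Proof.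
split; [|split] => r evr rng.
- by apply: switchable_P0 => //; apply: switchable_range.
(* Switching contributes the last 2 to the rank. *)
- have -> : r = (r - 2 + 2)%N by lia.
  by apply: switchable_Pplus => //; apply: switchable_range => //; lia.
- have -> : r = (r - 2 + 2)%N by lia.
  by apply: switchable_Pminus => //; apply: switchable_range => //; lia.
Qed.
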